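(* Let $\phi,\psi\in\mathrm{Sym}(d)$ be involutions, $\iota=(\phi,\psi)$, and let $M$ be a vertex of $B_d^\iota$. Let $U^M_{(\phi,\psi)}$ be the set of pairs $(p,q)$ of monic polynomials of degree $d$ in $\mathbb{R}[z]$ that have no multiple roots, that factorize as $p(z)=\prod_{i=1}^d(z-\alpha_i)$, $q(z)=\prod_{j=1}^d(z-\beta_j)$ with roots ordered so that $\overline{\alpha_i}=\alpha_{\phi(i)}$ and $\overline{\beta_j}=\beta_{\psi(j)}$ for all $i,j$, and for which (with this ordering) $M$ is the unique minimizer of $\mathrm{cost}(\cdot,p,q)$ in $B_d^\iota$. Then $U^M_{(\phi,\psi)}$ is open and non-empty.
   Context: Involution here means a permutation whose square is the identity (the identity is allowed). $B_d$ is the Birkhoff polytope of $d\times d$ doubly stochastic matrices, and $B_d^\iota=\{M\in B_d: M_{ij}=M_{\phi(i)\psi(j)}\ \forall i,j\}$. For $M\in B_d$, $\mathrm{cost}(M,p,q)=\frac1d\sum_{1\le i,j\le d}M_{ij}\|\alpha_i-\beta_j\|^2$, where $\|\cdot\|$ is the Euclidean norm on $\mathbb{C}$. Openness is in the space of pairs of monic real polynomials of degree $d$, identified with $\mathbb{R}^{d}\times\mathbb{R}^d$ via coefficients, with the Euclidean topology. A pair $(p,q)$ belongs to $U^M_{(\phi,\psi)}$ when an ordering of the roots with the stated properties exists. *)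

(* Defs.v *)
From HB Require Import structures.
From mathcomp Require Import all_boot all_order all_algebra all_fingroup.
From mathcomp Require Import complex.
From mathcomp Require Import all_classical all_reals all_analysis.

Set Implicit Arguments.
Unset Strict Implicit.
Unset Printing Implicit Defensive.

Import Order.TTheory GRing.Theory Num.Theory.
Import numFieldNormedType.Exports.

Local Open Scope classical_set_scope.
Local Open Scope ring_scope.

Definition birkhoff (R : realType) (d : nat) : set 'M[R]_d :=
  [set M | [/\ forall i j, 0 <= M i j,
               forall i, \sum_j M i j = 1 &
               forall j, \sum_i M i j = 1]].

Definition birkhoff_inv (R : realType) (d : nat) (phi psi : 'S_d) :
    set 'M[R]_d :=
  [set M | birkhoff M /\ forall i j, M i j = M (phi i) (psi j)].

(* A vertex of a polytope S is an extreme point of S. *)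
Definition vertex (R : realType) (V : lmodType R) (S : set V) (x : V) : Prop :=
  S x /\ forall (y z : V) (t : R), S y -> S z -> 0 < t < 1 ->
    x = t *: y + (1 - t) *: z -> y = x /\ z = x.

Definition minimizer (R : realType) (T : Type) (S : set T) (f : T -> R)
    (x : T) : Prop :=
  S x /\ forall y, S y -> f x <= f y.

Definition unique_minimizer (R : realType) (T : Type) (S : set T)
    (f : T -> R) (x : T) : Prop :=
  minimizer S f x /\ forall y, minimizer S f y -> y = x.

(* [Normc.normc] is the R-valued modulus on R[i]; the generic norm `|z| on R[i]
   is R[i]-valued. *)
Definition cost (R : realType) (d : nat) (alpha beta : 'I_d -> R[i])
    (M : 'M[R]_d) : R :=
  d%:R^-1 * \sum_i \sum_j M i j * (Normc.normc (alpha i - beta j)) ^+ 2.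

Definition no_multiple_root (R : realType) (p : {poly R}) : Prop :=
  forall z : R[i], (mup z (map_poly (real_complex R) p) <= 1)%N.

Definition ordered_roots (R : realType) (d : nat) (phi : 'S_d) (p : {poly R})
    (alpha : 'I_d -> R[i]) : Prop :=
  map_poly (real_complex R) p = \prod_(i < d) ('X - (alpha i)%:P) /\
  forall i, conjc (alpha i) = alpha (phi i).

Definition monic_of_degree (R : realType) (d : nat) : set {poly R} :=
  [set p | p \is monic /\ size p = d.+1].

Definition U_set (R : realType) (d : nat) (phi psi : 'S_d) (M : 'M[R]_d) :
    set ({poly R} * {poly R}) :=
  [set pq | [/\ monic_of_degree d pq.1 /\ monic_of_degree d pq.2,
                no_multiple_root pq.1 /\ no_multiple_root pq.2 &
                exists alpha beta : 'I_d -> R[i],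
                  [/\ ordered_roots phi pq.1 alpha,
                      ordered_roots psi pq.2 beta &
                      unique_minimizer (birkhoff_inv phi psi)
                        (cost alpha beta) M]]].

(* The identification of R^d with monic polynomials of degree d:
   a |-> X^d + a_{d-1} X^{d-1} + ... + a_0. *)
Definition monic_poly (R : realType) (d : nat) (a : 'rV[R]_d) : {poly R} :=
  'X^d + rVpoly a.

Definition monic_pair (R : realType) (d : nat) (ab : 'rV[R]_d * 'rV[R]_d) :
    {poly R} * {poly R} :=
  (monic_poly ab.1, monic_poly ab.2).

Lemma monic_poly_bij (R : realType) (d : nat) :
  set_bij setT (monic_of_degree d) (@monic_poly R d).
Proof.
split=> [a _|a b _ _|p [pm ps]].
- have sa : (size (rVpoly a) < size ('X^d : {poly R}))%N.
    by rewrite size_polyXn ltnS size_poly.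
  split; last by rewrite /monic_poly size_polyDl // size_polyXn.
  by rewrite /monic_poly monicE lead_coefDl // lead_coefXn.
- by move=> /addrI /(can_inj rVpolyK).
- exists (poly_rV (p - 'X^d)) => //.
  rewrite /monic_poly poly_rV_K ?subrKC //.
  apply/leq_sizeP => j dj; rewrite coefB coefXn.
  have [->|jd] := eqVneq j d.
    by move: pm; rewrite monicE lead_coefE ps /= => /eqP ->; rewrite subrr.
  by rewrite nth_default ?subr0 // ps ltn_neqAle eq_sym jd.
Qed.

(* Main.v *)
Require Import Defs.
From HB Require Import structures.
From mathcomp Require Import all_boot all_order all_algebra all_fingroup.
From mathcomp Require Import complex.
From mathcomp Require Import all_classical all_reals all_analysis.
From mathcomp Require Import zify ring lra.
Import Order.TTheory GRing.Theory Num.Theory.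
Import numFieldNormedType.Exports.

Local Open Scope ring_scope.

Set Implicit Arguments.
Unset Strict Implicit.
Unset Printing Implicit Defensive.

(** Write [sym_perm_mx P] for the average of the permutation matrix of [P] and
    of its image under the symmetry [(phi, psi)].

    Every invariant doubly stochastic matrix has a permutation in its support
    (Hall's theorem), hence also a matrix [sym_perm_mx P].  Subtracting as much
    of that matrix as possible and rescaling stays in the polytope and shrinks
    the support.  Three facts follow: a vertex is some [sym_perm_mx P]; a vertex
    is determined by its support; and [M] is the unique minimizer of the cost
    as soon as it beats the finitely many other matrices [sym_perm_mx P]
    ([unique_minimizer_sym_perm]).

    Openness.  The last fact turns the minimizing property into finitely many
    strict inequalities, which are stable when the roots move a little.  The
    roots do move a little with the coefficients: a monic polynomial of degree
    [d] that takes a value smaller than [e ^+ d] at [z] has a root closer than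
    [e] to [z] ([root_near]).  When the old roots are [2 * e]-separated, the new
    roots found in this way are distinct, so they are all the roots, and complex
    conjugation has to permute them as it permuted the old ones.

    Non-emptiness.  Let [M] be the vertex [sym_perm_mx P], and name the column
    [P i] after the row [i].  Then [psi] becomes an involution
    [tau = P^-1 psi P] of the rows, and row [i] is supported on the columns [i]
    and [sigma i], where [sigma = tau phi].  Since [phi] and [tau] are
    involutions they generate a dihedral action.  Extremality of [M] forces each
    orbit to be of one of two kinds ([vertex_orbit_symmetric]).  Either the
    orbit is a single cycle of [sigma] of some length [n], which [phi] reverses;
    then its [n] rows and [n] columns are placed alternately on a regular
    [2n]-gon that is symmetric under conjugation, each row having the two columns
    of its support as neighbours ([polygon_embedding]).  Or the orbit is a pair
    of rows exchanged by [phi], each supported on one column; then rows and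
    columns are placed at ['i] and [- 'i] ([conjugate_pair_embedding]).  In both
    cases, the squared distance from a row to a column is smallest, equal to a
    constant of the orbit, exactly on the support of [M].  Translating the orbits
    far apart along the real axis makes this true globally, so these constants
    are a dual certificate: only matrices supported in the support of [M] reach
    the minimal cost, and [M] is the only one of them
    ([potential_unique_minimizer]). *)

(** * Permutations in the support of a doubly stochastic matrix *)

(** The Halmos-Vaughan induction: either some proper non-empty
    subset is matched tightly, and the problem splits into that subset and its
    complement, or every proper subset has a spare neighbour, and an arbitrary
    first choice leaves the condition true.  The value [y0] is taken outside
    [A]. *)
Lemma hall_in (I J : finType) (y0 : J) (N : I -> {set J}) (A : {set I}) :
  (forall S : {set I}, S \subset A -> (#|S| <= #|\bigcup_(i in S) N i|)%N) ->
  exists f : I -> J, {in A &, injective f} /\ {in A, forall i, f i \in N i}.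
Proof.
move: {2}#|A| (leqnn #|A|) => n; elim: n N A => [|n IHn] N A leAn hallN.
  exists (fun=> y0); move: leAn; rewrite leqn0 cards_eq0 => /eqP ->.
  by split=> [i j|i]; rewrite inE.
have [->|[a aA]] := set_0Vmem A.
  by exists (fun=> y0); split=> [i j|i]; rewrite inE.
case: (pselect (exists S : {set I}, [/\ S \proper A, S != finset.set0 &
   #|\bigcup_(i in S) N i| = #|S| ])) => [[S [pSA S0 cS]]|ncrit].
  have SA := proper_sub pSA.
  (* The tight set [S] and its complement, which avoids the neighbours of [S]. *)
  have [f [finj fN]] : exists f : I -> J,
      {in S &, injective f} /\ {in S, forall i, f i \in N i}.
    apply: IHn => [|T TS]; first by have := proper_card pSA; lia.
    exact/hallN/(fintype.subset_trans TS).
  set NS := (\bigcup_(i in S) N i)%SET in cS.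
  have [g [ginj gN]] : exists g : I -> J,
      {in (A :\: S)%SET &, injective g} /\
      {in (A :\: S)%SET, forall i, g i \in (N i :\: NS)%SET}.
    apply: IHn => [|T TAS].
      have := cardsID S A; rewrite (finset.setIidPr SA) => cA.
      by move: S0; rewrite -card_gt0; lia.
    have [TA dTS] := finset.subsetDP TAS.
    have /hallN : (T :|: S)%SET \subset A by rewrite finset.subUset TA.
    rewrite finset.bigcup_setU -/NS.
    have -> : #|(T :|: S)%SET| = (#|T| + #|S|)%N.
      by apply/eqP; rewrite (leq_card_setU T S).
    have : (\bigcup_(i in T) N i :|: NS)%SET \subset
           ((\bigcup_(i in T) (N i :\: NS)) :|: NS)%SET.
      rewrite finset.subUset finset.subsetUr andbT; apply/bigcupsP => i iT.
      apply/fintype.subsetP => j jN; rewrite inE; have [//|jNS] := boolP (j \in NS).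
        by rewrite orbT.
      by apply/orP; left; apply/bigcupP; exists i => //; rewrite inE jNS.
    move=> /subset_leq_card c1.
    have := (leq_card_setU (\bigcup_(i in T) (N i :\: NS)) NS)%SET.1.
    by move: c1; rewrite cS; lia.
  have fNS i : i \in S -> f i \in NS by move=> iS; apply/bigcupP; exists i => //; apply: fN.
  have gNS i : i \in A -> i \notin S -> (g i \in N i) && (g i \notin NS).
    by move=> iA iS; have := gN i; rewrite !inE iA iS andbC; apply.
  exists (fun i => if i \in S then f i else g i); split=> [i j iA jA|i iA].
    case: ifPn => iS; case: ifPn => jS; first exact: finj.
    - by move=> fg; have /andP[_] := gNS j jA jS; rewrite -fg fNS.
    - by move=> fg; have /andP[_] := gNS i iA iS; rewrite fg fNS.
    - by apply: ginj; rewrite inE ?iS ?jS.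
  by case: ifPn => iS; [apply: fN | have /andP[] := gNS i iA iS].
have /hallN : [set a]%SET \subset A by rewrite finset.sub1set.
rewrite cards1 big_set1 card_gt0 => /set0Pn[b bN].
have [f [finj fN]] : exists f : I -> J,
    {in (A :\ a)%SET &, injective f} /\
    {in (A :\ a)%SET, forall i, f i \in (N i :\ b)%SET}.
  apply: IHn => [|T TA].
    by have := cardsD1 a A; rewrite aA; lia.
  have [->|T0] := eqVneq T finset.set0; first by rewrite cards0.
  have pTA : T \proper A.
    apply/properP; split; first exact: fintype.subset_trans TA (finset.subsetDl _ _).
    by exists a => //; apply/negP => /(fintype.subsetP TA); rewrite !inE eqxx.
  have lt : (#|T| < #|\bigcup_(i in T) N i|)%N.
    rewrite ltn_neqAle hallN ?proper_sub // andbT; apply/eqP => cT.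
    by apply: ncrit; exists T.
  have /subset_leq_card : (\bigcup_(i in T) N i)%SET \subset
           (b |: (\bigcup_(i in T) (N i :\ b)))%SET.
    apply/bigcupsP => i iT; apply/fintype.subsetP => j jN; rewrite !inE.
    have [//|jb] := eqVneq j b.
    by apply/bigcupP; exists i => //; rewrite !inE jb.
  rewrite cardsU1; case: (b \notin _); lia.
exists (fun i => if i == a then b else f i); split=> [i j iA jA|i iA].
  case: eqVneq => [->|ia]; case: eqVneq => [->|ja] //.
  - by move=> e; have := fN j; rewrite !inE ja jA -e eqxx => /(_ isT).
  - by move=> e; have := fN i; rewrite !inE ia iA e eqxx => /(_ isT).
  - by apply: finj; rewrite !inE ?ia ?ja.
case: eqVneq => [->//|ia].
by have := fN i; rewrite !inE ia iA => /(_ isT)/andP[].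
Qed.

Local Open Scope classical_set_scope.

(** Hall's condition is double counting: the rows in a set [S] carry total
    mass [#|S|], all of it in columns that meet their support, and each column
    has mass one. *)
Lemma birkhoff_positive_diagonal (R : realType) (d : nat) (N : 'M[R]_d) :
  birkhoff N -> exists P : 'S_d, forall i, N i (P i) != 0.
Proof.
case: d N => [|d] N [N0 Nr Nc]; first by exists 1%g => -[].
pose supp i : {set 'I_d.+1} := [set j | N i j != 0]%SET.
have [S _|f [finj fN]] := @hall_in _ _ ord0 supp finset.setT.
  rewrite -(ler_nat R) -!sum1_card !natr_sum.
  under eq_bigr => i _ do rewrite -(Nr i).
  under [leRHS]eq_bigr => j _ do rewrite -(Nc j).
  rewrite exchange_big /= [leRHS]big_mkcond /=; apply: ler_sum => j _.
  case: ifPn => [_|jS].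
    rewrite [leLHS]big_mkcond /=; apply: ler_sum => i _.
    by case: ifP.
  rewrite big1 // => i iS; apply/eqP; apply: contraNT jS => Nij.
  by apply/bigcupP; exists i; rewrite // inE.
have finj' : injective f by move=> i j; apply: finj; rewrite inE.
by exists (perm finj') => i; rewrite permE; have := fN i; rewrite !inE; apply.
Qed.

(** * Symmetrized permutation matrices and vertices *)

Lemma perm_mx_birkhoff (R : realType) (d : nat) (P : 'S_d) :
  birkhoff (perm_mx P : 'M[R]_d).
Proof.
split=> [i j|i|j]; first by rewrite !mxE; case: eqP.
  rewrite (bigD1 (P i)) //= !mxE eqxx big1 ?addr0 // => j jP.
  by rewrite !mxE eq_sym (negbTE jP).
rewrite (bigD1 (P^-1 j)%g) //= !mxE permKV eqxx big1 ?addr0 // => i iP.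
by rewrite !mxE -(inj_eq (@perm_inj _ P^-1%g)) permK (negbTE iP).
Qed.

Definition sym_perm_mx (R : realType) (d : nat) (phi psi P : 'S_d) : 'M[R]_d :=
  2^-1 *: (perm_mx P + perm_mx (phi * P * psi)%g).

Lemma sym_perm_mxE (R : realType) (d : nat) (phi psi P : 'S_d) i j :
  sym_perm_mx R phi psi P i j =
  2^-1 * ((P i == j)%:R + (psi (P (phi i)) == j)%:R).
Proof. by rewrite !mxE !permM. Qed.

Lemma sym_perm_mx_neq0 (R : realType) (d : nat) (phi psi P : 'S_d) i j :
  (sym_perm_mx R phi psi P i j != 0) = (P i == j) || (psi (P (phi i)) == j).
Proof.
rewrite sym_perm_mxE mulf_eq0 invr_eq0 pnatr_eq0 /= -natrD pnatr_eq0.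
by case: (P i == j); case: (_ == j).
Qed.

Lemma sym_perm_mx_birkhoff_inv (R : realType) (d : nat) (phi psi P : 'S_d) :
  involutive phi -> involutive psi ->
  birkhoff_inv phi psi (sym_perm_mx R phi psi P).
Proof.
move=> phiK psiK; split; last first.
  move=> i j; rewrite !sym_perm_mxE phiK (inj_eq (inv_inj psiK)) addrC.
  by rewrite (inv_eq psiK).
have [A0 Ar Ac] := perm_mx_birkhoff R P.
have [B0 Br Bc] := perm_mx_birkhoff R (phi * P * psi)%g.
split=> [i j|i|j].
- by rewrite mxE mulr_ge0 ?invr_ge0 // mxE addr_ge0.
- under eq_bigr do rewrite mxE [X in _ * X]mxE.
  by rewrite -mulr_sumr big_split /= Ar Br mulVf.
- under eq_bigr do rewrite mxE [X in _ * X]mxE.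
  by rewrite -mulr_sumr big_split /= Ac Bc mulVf.
Qed.

(** Take for [t] the smallest ratio [N i j / V i j] over the support of [V]:
    it is the largest multiple of [V] that fits under [N], so removing it
    empties an entry.  If it were at least one, [N] would dominate [V] with the
    same row sums. *)
Lemma birkhoff_inv_split (R : realType) (d : nat) (phi psi : 'S_d)
    (V N : 'M[R]_d) :
  birkhoff_inv phi psi V -> birkhoff_inv phi psi N ->
  (forall i j, V i j != 0 -> N i j != 0) -> V != N ->
  exists (t : R) (N' : 'M[R]_d),
    [/\ 0 < t < 1, birkhoff_inv phi psi N', N = t *: V + (1 - t) *: N',
        forall i j, N' i j != 0 -> N i j != 0 &
        exists i j, N i j != 0 /\ N' i j = 0].
Proof.
move=> [[V0 Vr Vc] Vi] [[N0 Nr Nc] Ni] VN VneqN.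
have [p0 Vp0] : exists p : 'I_d * 'I_d, V p.1 p.2 != 0.
  have [i [j _]] : exists i j, V i j != N i j.
    apply: contrapT => h; move/negP: VneqN; apply; apply/eqP/matrixP => i j.
    by apply/eqP; apply: contrapT => /negP h'; apply: h; exists i, j.
  move: (Vr i); apply: contra_eqP => /forallNP h; rewrite big1.
    by rewrite eq_sym oner_eq0.
  by move=> k _; apply/eqP; have /negP := h (i, k); rewrite negbK.
pose q (p : 'I_d * 'I_d) := N p.1 p.2 / V p.1 p.2.
have [[a b] /= Vab tmin] := @Order.TotalTheory.arg_minP _ R _ p0
  (fun p => V p.1 p.2 != 0) q Vp0.
rewrite {1}/q /= in tmin.
set t := N a b / V a b in tmin.
have lVab : 0 < V a b by rewrite lt_def Vab V0.
have lNab : 0 < N a b by rewrite lt_def VN ?N0.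
have t0 : 0 < t by rewrite divr_gt0.
have tV i j : t * V i j <= N i j.
  have [->|Vij] := eqVneq (V i j) 0; first by rewrite mulr0.
  have lVij : 0 < V i j by rewrite lt_def Vij V0.
  by rewrite -ler_pdivlMr //; exact: (tmin (i, j)).
have t1 : t < 1.
  rewrite ltNge; apply: contra VneqN => t1; apply/eqP/matrixP => i j.
  have VleN k : V i k <= N i k.
    by apply: le_trans (tV i k); rewrite ler_peMl.
  have : \sum_k (N i k - V i k) == 0 by rewrite sumrB Nr Vr subrr.
  rewrite psumr_eq0 => [|k _]; last by rewrite subr_ge0.
  by move=> /allP/(_ j); rewrite mem_index_enum subr_eq0 => /(_ isT)/eqP.
have s0 : 0 < 1 - t by rewrite subr_gt0.
have sneq0 : 1 - t != 0 by rewrite gt_eqF.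
exists t, ((1 - t)^-1 *: (N - t *: V)); split.
- by rewrite t0 t1.
- split; last by move=> i j; rewrite !mxE Vi Ni.
  split=> [i j|i|j].
  + by rewrite !mxE mulr_ge0 ?invr_ge0 ?(ltW s0) // subr_ge0.
  + under eq_bigr do rewrite !mxE.
    by rewrite -mulr_sumr sumrB -mulr_sumr Nr Vr mulr1 mulVf.
  + under eq_bigr do rewrite !mxE.
    by rewrite -mulr_sumr sumrB -mulr_sumr Nc Vc mulr1 mulVf.
- by rewrite scalerA mulfV // scale1r subrKC.
- move=> i j; apply: contra => /eqP Nij; rewrite !mxE.
  have [->|/VN] := eqVneq (V i j) 0; first by rewrite Nij mulr0 subrr mulr0.
  by rewrite Nij eqxx.
- exists a, b; split; first by rewrite VN.
  by rewrite !mxE /t divfK // subrr mulr0.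
Qed.

Lemma birkhoff_inv_supported_perm (R : realType) (d : nat) (phi psi : 'S_d)
    (N : 'M[R]_d) :
  involutive phi -> involutive psi -> birkhoff_inv phi psi N ->
  exists P : 'S_d, forall i j, sym_perm_mx R phi psi P i j != 0 -> N i j != 0.
Proof.
move=> phiK psiK [/birkhoff_positive_diagonal[P NP] Ni]; exists P => i j.
by rewrite sym_perm_mx_neq0 => /orP[]/eqP <-; [|rewrite Ni psiK]; apply: NP.
Qed.

(** A matrix [N] supported in the support of [M] can be split off [M], so [M]
    is a proper convex combination involving [N] unless they are equal. *)
Lemma vertex_support (R : realType) (d : nat) (phi psi : 'S_d)
    (M N : 'M[R]_d) :
  vertex (birkhoff_inv phi psi) M -> birkhoff_inv phi psi N ->
  (forall i j, N i j != 0 -> M i j != 0) -> N = M.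
Proof.
move=> [KM extM] KN supp; apply/eqP; apply/negP => /negP NM.
have [t [N' [t01 KN' e _ _]]] := birkhoff_inv_split KN KM supp NM.
by move: NM; have [-> _] := extM _ _ _ KN KN' t01 e; rewrite eqxx.
Qed.

Lemma vertex_sym_perm (R : realType) (d : nat) (phi psi : 'S_d)
    (M : 'M[R]_d) :
  involutive phi -> involutive psi -> vertex (birkhoff_inv phi psi) M ->
  exists P : 'S_d, M = sym_perm_mx R phi psi P.
Proof.
move=> phiK psiK vM; have [P supp] := birkhoff_inv_supported_perm phiK psiK vM.1.
exists P; apply/esym/(vertex_support vM) => //.
exact: sym_perm_mx_birkhoff_inv.
Qed.

Lemma cost_affine (R : realType) (d : nat) (alpha beta : 'I_d -> R[i])
    (V N : 'M[R]_d) (t : R) :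
  cost alpha beta (t *: V + (1 - t) *: N) =
  t * cost alpha beta V + (1 - t) * cost alpha beta N.
Proof.
rewrite /cost [t * _]mulrCA [(1 - t) * _]mulrCA -mulrDr; congr (_ * _).
rewrite !mulr_sumr -big_split /=; apply: eq_bigr => i _.
rewrite !mulr_sumr -big_split /=; apply: eq_bigr => j _.
by rewrite !mxE; ring.
Qed.

(** Reduces uniqueness over the whole polytope to a finite test.  For the
    converse direction, an arbitrary matrix is peeled into matrices
    [sym_perm_mx P] by induction on the size of its support, the cost being
    affine. *)
Lemma unique_minimizer_sym_perm (R : realType) (d : nat) (phi psi : 'S_d)
    (alpha beta : 'I_d -> R[i]) (M : 'M[R]_d) :
  involutive phi -> involutive psi -> birkhoff_inv phi psi M ->
  unique_minimizer (birkhoff_inv phi psi) (cost alpha beta) M <->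
  forall P : 'S_d, sym_perm_mx R phi psi P != M ->
    cost alpha beta M < cost alpha beta (sym_perm_mx R phi psi P).
Proof.
move=> phiK psiK KM; split=> [[[_ minM] uniqM] P PM|ltM].
  have KP := sym_perm_mx_birkhoff_inv R P phiK psiK.
  rewrite lt_neqAle minM // andbT; apply: contra PM => /eqP e.
  by apply/eqP/uniqM; split=> // N KN; rewrite -e minM.
suff minM N : birkhoff_inv phi psi N ->
    cost alpha beta M <= cost alpha beta N /\
    (cost alpha beta N <= cost alpha beta M -> N = M).
  split; first by split=> // N /minM[].
  by move=> N [KN /(_ _ KM)]; have [_] := minM _ KN.
pose supp (N : 'M[R]_d) := [set p : 'I_d * 'I_d | N p.1 p.2 != 0]%SET.
move: {2}#|supp N| (leqnn #|supp N|) => n.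
elim: n N => [|n IHn] N leNn KN.
  suff -> : N = M by [].
  apply/matrixP => i j; have [_ Nr _] := KN.1.
  move: (Nr i); rewrite big1 => [/esym/eqP|k _]; first by rewrite oner_eq0.
  move: leNn; rewrite leqn0 cards_eq0 => /eqP/setP/(_ (i, k)).
  by rewrite !inE => /negbFE/eqP.
have [P suppP] := birkhoff_inv_supported_perm phiK psiK KN.
set V := sym_perm_mx R phi psi P in suppP.
have KV : birkhoff_inv phi psi V by exact: sym_perm_mx_birkhoff_inv.
have leV : cost alpha beta M <= cost alpha beta V /\
    (cost alpha beta V <= cost alpha beta M -> V = M).
  have [->//|VM] := eqVneq V M.
  have lt := ltM P VM; split; first exact: ltW.
  by rewrite leNgt lt.
have [<-//|VN] := eqVneq V N.
have [t [N' [/andP[t0 t1] KN' e suppN' [a [b [Nab N'ab]]]]]] :=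
  birkhoff_inv_split KV KN suppP VN.
have [leN' eqN'] : cost alpha beta M <= cost alpha beta N' /\
    (cost alpha beta N' <= cost alpha beta M -> N' = M).
  apply: IHn => //; rewrite -ltnS; apply: leq_trans leNn.
  apply: proper_card; apply/fintype.properP; split.
    by apply/fintype.subsetP => -[i j]; rewrite !inE; apply: suppN'.
  by exists (a, b); rewrite !inE /= ?N'ab ?eqxx.
have [leVM eqV] := leV.
have s0 : 0 < 1 - t by rewrite subr_gt0.
set cM := cost _ _ M in leVM leN' eqV eqN' *.
have cME : cM = t * cM + (1 - t) * cM by ring.
rewrite e cost_affine; split.
  by rewrite {1}cME lerD // ler_wpM2l // ltW.
move=> le.
have -> : V = M.
  apply: eqV; rewrite -(ler_pM2l t0) -(lerD2r ((1 - t) * cM)) -cME.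
  by apply: le_trans le; rewrite lerD2l ler_wpM2l // ltW.
have -> : N' = M.
  apply: eqN'; rewrite -(ler_pM2l s0) -(lerD2l (t * cM)) -cME.
  by apply: le_trans le; rewrite lerD2r ler_wpM2l // ltW.
by rewrite -scalerDl subrKC scale1r.
Qed.

(** * Stability of ordered roots *)

Lemma normc_ge0 (R : realType) (z : R[i]) : 0 <= Normc.normc z.
Proof. by case: z => a b; apply: sqrtr_ge0. Qed.

Lemma normc_conj (R : realType) (z : R[i]) :
  Normc.normc (conjc z) = Normc.normc z.
Proof. by case: z => a b /=; rewrite sqrrN. Qed.

Lemma normc_distC (R : realType) (z w : R[i]) :
  Normc.normc (z - w) = Normc.normc (w - z).
Proof. by rewrite -normcN opprB. Qed.

Lemma normc_triangle (R : realType) (x y z : R[i]) :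
  Normc.normc (x - z) <= Normc.normc (x - y) + Normc.normc (y - z).
Proof. by rewrite -[x - z](subrKA y) le_normcD. Qed.

Lemma normc_sum (R : realType) (I : Type) (r : seq I) (F : I -> R[i]) :
  Normc.normc (\sum_(i <- r) F i) <= \sum_(i <- r) Normc.normc (F i).
Proof.
elim: r => [|i r IHr]; first by rewrite !big_nil Normc.normc0.
by rewrite !big_cons (le_trans (le_normcD _ _)) ?lerD2l.
Qed.

Lemma normc_prod (R : realType) (I : Type) (r : seq I) (F : I -> R[i]) :
  Normc.normc (\prod_(i <- r) F i) = \prod_(i <- r) Normc.normc (F i).
Proof. exact: (big_morph _ (@Normc.normcM R) (Normc.normc1 R)). Qed.

Lemma normcX (R : realType) (z : R[i]) n :
  Normc.normc (z ^+ n) = Normc.normc z ^+ n.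
Proof.
by elim: n => [|n IHn]; rewrite ?expr0 ?Normc.normc1 // !exprS Normc.normcM IHn.
Qed.

Lemma normc_real (R : realType) (x : R) : Normc.normc (real_complex R x) = `|x|.
Proof. by rewrite /= expr0n addr0 sqrtr_sqr. Qed.

(** A monic polynomial is, in absolute value at [z], the product of the
    distances from [z] to its [d] roots. *)
Lemma root_near (R : realType) (d : nat) (q : {poly R[i]}) (z : R[i]) (e : R) :
  q \is monic -> size q = d.+1 -> 0 < e -> Normc.normc q.[z] < e ^+ d ->
  exists2 w, root q w & Normc.normc (w - z) < e.
Proof.
move=> qm qs e0 qz; have [r qE] := closed_field_poly_normal q.
move: qE; rewrite (monicP qm) scale1r => qE.
have rs : size r = d by move: qs; rewrite qE size_prod_XsubC => -[].
apply: contrapT => far; move: qz; rewrite ltNge => /negP; apply.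
rewrite qE horner_prod normc_prod -rs.
have -> : e ^+ size r = \prod_(w <- r) e by rewrite big_const_seq count_predT iter_mulr_1.
rewrite big_seq [leRHS]big_seq; apply: ler_prod => w wr.
rewrite (ltW e0) hornerXsubC normc_distC leNgt; apply/negP => lt.
by apply: far; exists w => //; rewrite qE root_prod_XsubC.
Qed.

Lemma no_multiple_rootE (R : realType) (d : nat) (p : {poly R})
    (alpha : 'I_d -> R[i]) :
  map_poly (real_complex R) p = \prod_(i < d) ('X - (alpha i)%:P) ->
  no_multiple_root p <-> injective alpha.
Proof.
move=> pE.
have q0 (A : pred 'I_d) : \prod_(i < d | A i) ('X - (alpha i)%:P) != 0.
  by apply/prodf_neq0 => i _; rewrite polyXsubC_eq0.
split=> [mul1 i j e|inj z].
  have [//|ij] := eqVneq i j; have := mul1 (alpha i).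
  rewrite pE mup_leq ?q0 // => /negP[].
  rewrite (bigD1 i) //= (bigD1 j) 1?eq_sym //= -e mulrA -expr2.
  exact: dvdp_mulr.
rewrite pE; have [zroot|/mupNroot -> //] :=
  boolP (root (\prod_(i < d) ('X - (alpha i)%:P)) z).
have [i zi] : exists i, z = alpha i.
  apply: contrapT => /forallNP nz; move: zroot; rewrite rootE horner_prod.
  apply/negP/prodf_neq0 => i _; rewrite hornerXsubC subr_eq0.
  by apply/eqP; apply: nz.
rewrite (bigD1 i) //= mupMl; first by rewrite -['X - _]expr1 mup_XsubCX; case: ifP.
rewrite rootE horner_prod; apply/prodf_neq0 => j ji.
rewrite hornerXsubC subr_eq0 zi; apply: contra ji => /eqP e.
by rewrite (inj _ _ e).
Qed.

(** The separation of the points [alpha i] makes a point within [e] of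
    [alpha i] identify [i]: this gives distinctness of the new roots, and shows
    that the conjugate of the new root near [alpha i] is the one near
    [alpha (phi i)]. *)
Lemma perturbed_ordered_roots (R : realType) (d : nat) (phi : 'S_d)
    (p : {poly R}) (alpha : 'I_d -> R[i]) (e : R) :
  0 < e -> (forall i j, i != j -> 2 * e <= Normc.normc (alpha i - alpha j)) ->
  (forall i, conjc (alpha i) = alpha (phi i)) -> monic_of_degree d p ->
  (forall i, Normc.normc (map_poly (real_complex R) p).[alpha i] < e ^+ d) ->
  exists alpha' : 'I_d -> R[i],
    [/\ ordered_roots phi p alpha', no_multiple_root p &
        forall i, Normc.normc (alpha' i - alpha i) < e].
Proof.
move=> e0 sep alphaJ [pm ps] pz; set q := map_poly _ p in pz.
have qm : q \is monic by rewrite map_monic.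
have qs : size q = d.+1 by rewrite size_map_poly.
have /choice[alpha' alpha'P] i : exists w, root q w /\ Normc.normc (w - alpha i) < e.
  by have [w ? ?] := root_near qm qs e0 (pz i); exists w.
have aroot i := (alpha'P i).1; have anear i := (alpha'P i).2.
have close i k w : Normc.normc (w - alpha i) < e ->
    Normc.normc (w - alpha k) < e -> i = k.
  move=> wi wk; apply/eqP; apply: contraT => /sep; rewrite leNgt => /negP[].
  have := normc_triangle (alpha i) w (alpha k).
  by rewrite (normc_distC _ w) => /le_lt_trans; apply; rewrite mulr_natl mulr2n ltrD.
have ainj : injective alpha'.
  by move=> i k ik; apply: (close i k (alpha' i)) => //; rewrite ik.
have qE : q = \prod_(i < d) ('X - (alpha' i)%:P).
  pose rs := [seq alpha' i | i <- enum 'I_d].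
  have -> : \prod_(i < d) ('X - (alpha' i)%:P) = \prod_(z <- rs) ('X - z%:P).
    by rewrite big_map big_enum.
  apply/esym/eqP; rewrite -eqp_monic ?monic_prod_XsubC //.
  rewrite -dvdp_size_eqp.
    by rewrite size_prod_XsubC size_map -cardE card_ord qs.
  apply: uniq_roots_dvdp; first by apply/allP => _ /mapP[i _ ->].
  by rewrite uniq_rootsE map_inj_uniq // enum_uniq.
exists alpha'; split=> //; last exact/(no_multiple_rootE qE).
split=> // i.
have qJ : map_poly conjc q = q.
  by rewrite -map_poly_comp; apply: eq_map_poly => x /=; rewrite oppr0.
have : root q (conjc (alpha' i)) by rewrite -complex_root_conj qJ.
rewrite {1}qE -(big_enum _ _ _ (fun i => 'X - (alpha' i)%:P)) /=.
rewrite -(big_map alpha' predT (fun z => 'X - z%:P)) root_prod_XsubC.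
move=> /mapP[k _ e']; rewrite e'; congr alpha'.
apply: (close _ _ (alpha' k)) => //; rewrite -e' -alphaJ -rmorphB.
by rewrite normc_conj.
Qed.

(** At a fixed point [z], the value is an affine function of the
    coefficients. *)
Lemma near_monic_poly_horner (R : realType) (d : nat) (a : 'rV[R]_d) (z : R[i])
    (e : R) :
  0 < e -> \forall b \near a,
    Normc.normc ((map_poly (real_complex R) (monic_poly b)).[z] -
                 (map_poly (real_complex R) (monic_poly a)).[z]) < e.
Proof.
move=> e0; pose S := \sum_(k < d) Normc.normc z ^+ k.
have S0 : 0 <= S by apply: sumr_ge0 => k _; rewrite exprn_ge0 // normc_ge0.
have S10 : 0 < S + 1 by rewrite ltr_wpDl.
have f0 : 0 < e / (S + 1) by rewrite divr_gt0.
apply/nbhs_ballP; exists (e / (S + 1)) => // b ab.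
have ba : monic_poly b - monic_poly a = rVpoly (b - a).
  by rewrite /monic_poly linearB /= opprD addrACA subrr add0r.
rewrite -hornerN -hornerD -rmorphB ba.
rewrite (@horner_coef_wide _ d); last first.
  by rewrite (leq_trans (size_poly _ _)) // size_poly.
apply: le_lt_trans (normc_sum _ _) _.
apply: (@le_lt_trans _ _ (e / (S + 1) * S)).
  rewrite mulr_sumr; apply: ler_sum => k _.
  rewrite Normc.normcM normcX ler_wpM2r ?exprn_ge0 ?normc_ge0 //.
  rewrite coef_map coef_rVpoly_ord normc_real !mxE.
  by have [_ /(_ 0 k)] := ab; rewrite /ball /= distrC => /ltW.
by rewrite -mulrA gtr_pMr // mulrC ltr_pdivrMr // mul1r ltrDl.
Qed.

(** * Openness *)

Lemma cost_diff (R : realType) (d : nat) (alpha beta : 'I_d -> R[i])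
    (V N : 'M[R]_d) :
  cost alpha beta V - cost alpha beta N =
  d%:R^-1 * \sum_i \sum_j
    (V i j - N i j) * (Normc.normc (alpha i - beta j)) ^+ 2.
Proof.
rewrite /cost -mulrBr -sumrB; congr (_ * _); apply: eq_bigr => i _.
by rewrite -sumrB; apply: eq_bigr => j _; rewrite mulrBl.
Qed.

Lemma near0_le (R : realType) (Q : R -> Prop) (e : R) : 0 < e ->
  (forall x, 0 < x -> x <= e -> Q x) -> \forall x \near 0^'+, Q x.
Proof.
move=> e0 Qe; near=> x; apply: Qe; near: x.
  exact: nbhs_right_gt.
exact: nbhs_right_le.
Unshelve. all: by end_near. Qed.

(** The cost is a finite sum of squared distances, each of which varies by
    at most [4 * e * (n + 1)] when both of its ends move by less than [e <= 1],
    where [n] is the original distance. *)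
Lemma near0_cost_lt (R : realType) (d : nat) (alpha beta : 'I_d -> R[i])
    (V N : 'M[R]_d) :
  cost alpha beta N < cost alpha beta V ->
  \forall e \near 0^'+, forall alpha' beta' : 'I_d -> R[i],
    (forall i, Normc.normc (alpha' i - alpha i) < e) ->
    (forall j, Normc.normc (beta' j - beta j) < e) ->
    cost alpha' beta' N < cost alpha' beta' V.
Proof.
(* [d%:R^-1 * F a b] is the gap between the two costs. *)
pose F (a b : 'I_d -> R[i]) := \sum_i \sum_j
    (V i j - N i j) * (Normc.normc (a i - b j)) ^+ 2.
have costF a b : (cost a b N < cost a b V) = (0 < d%:R^-1 * F a b).
  by rewrite -subr_gt0 cost_diff.
rewrite costF => dF0.
have d0 : 0 < (d%:R^-1 : R).
  rewrite lt_def invr_ge0 ler0n andbT; apply: contraTneq dF0 => ->.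
  by rewrite mul0r ltxx.
rewrite pmulr_rgt0 // in dF0.
pose n i j := Normc.normc (alpha i - beta j).
pose B := \sum_i \sum_j `|V i j - N i j| * (4 * (n i j + 1)).
have n0 i j : 0 <= n i j by apply: normc_ge0.
have B0 : 0 <= B.
  apply: sumr_ge0 => i _; apply: sumr_ge0 => j _.
  by rewrite mulr_ge0 // mulr_ge0 // addr_ge0.
have B1 : 0 < B + 1 by rewrite ltr_wpDl.
apply: (@near0_le _ _ (Num.min 1 (F alpha beta / (B + 1)))).
  by rewrite lt_min ltr01 divr_gt0.
move=> e e0; rewrite le_min => /andP[e1 eF] a b ha hb.
rewrite costF mulr_gt0 //.
suff le : F alpha beta - F a b <= e * B.
  suff : e * B < F alpha beta by move: le; lra.
  rewrite ler_pdivlMr // in eF.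
  by apply: lt_le_trans eF; rewrite ltr_pM2l // ltrDl.
rewrite /F -sumrB mulr_sumr; apply: ler_sum => i _.
rewrite -sumrB mulr_sumr; apply: ler_sum => j _.
rewrite -mulrBr; apply: le_trans (ler_norm _) _.
rewrite normrM mulrCA; apply: ler_wpM2l => //.
set x := Normc.normc (a i - b j); rewrite -/(n i j).
have x0 : 0 <= x by apply: normc_ge0.
have xn : x <= n i j + 2 * e.
  have := normc_triangle (a i) (alpha i) (b j).
  have := normc_triangle (alpha i) (beta j) (b j).
  by have := ha i; have := hb j; rewrite (normc_distC (b j)) -/(n i j) -/x; lra.
have nx : n i j <= x + 2 * e.
  have := normc_triangle (alpha i) (a i) (beta j).
  have := normc_triangle (a i) (b j) (beta j).
  by have := ha i; have := hb j; rewrite (normc_distC (a i)) -/(n i j) -/x; lra.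
have := n0 i j; move: (n i j) xn nx => m xn nx m0.
rewrite ler_norml; apply/andP; split; nra.
Qed.

Lemma near0_separated (R : realType) (d : nat) (alpha : 'I_d -> R[i]) :
  injective alpha -> \forall e \near (0 : R)^'+,
    forall i j, i != j -> 2 * e <= Normc.normc (alpha i - alpha j).
Proof.
move=> inj; apply: filter_forall => i; apply: filter_forall => j.
have [->|ij] := eqVneq i j; first by apply: nearW => e /eqP.
set n := Normc.normc _.
have n0 : 0 < n.
  rewrite lt_def normc_ge0 andbT; apply: contra ij => /eqP/Normc.eq0_normc/eqP.
  by rewrite subr_eq0 => /eqP/inj ->.
by apply: (@near0_le _ _ (n / 2)) => [|e e0 en _]; [rewrite divr_gt0|lra].
Qed.

Lemma near_perturbed_roots (R : realType) (d : nat) (phi : 'S_d)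
    (a : 'rV[R]_d) (alpha : 'I_d -> R[i]) (e : R) :
  0 < e -> (forall i j, i != j -> 2 * e <= Normc.normc (alpha i - alpha j)) ->
  ordered_roots phi (monic_poly a) alpha ->
  \forall b \near a, exists alpha' : 'I_d -> R[i],
    [/\ ordered_roots phi (monic_poly b) alpha', no_multiple_root (monic_poly b) &
        forall i, Normc.normc (alpha' i - alpha i) < e].
Proof.
move=> e0 sep [aE alphaJ].
have az i : (map_poly (real_complex R) (monic_poly a)).[alpha i] = 0.
  by rewrite aE horner_prod (bigD1 i) //= hornerXsubC subrr mul0r.
have : \forall b \near a, forall i,
    Normc.normc ((map_poly (real_complex R) (monic_poly b)).[alpha i]) < e ^+ d.
  apply: (filter_forall (nbhs_filter a)) => i.
  have /near_monic_poly_horner : 0 < e ^+ d by rewrite exprn_gt0.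
  move=> /(_ d a (alpha i)); apply: filterS => b.
  by rewrite az subr0.
apply: filterS => b hb; apply: perturbed_ordered_roots hb => //.
by have [homo _ _] := monic_poly_bij R d; apply: homo.
Qed.

(** One radius [e] must separate both families of roots and preserve all the
    inequalities of [unique_minimizer_sym_perm]: these are finitely many
    conditions, each true for small [e]. *)
Lemma open_U_set (R : realType) (d : nat) (phi psi : 'S_d) (M : 'M[R]_d) :
  involutive phi -> involutive psi ->
  open (@monic_pair R d @^-1` U_set phi psi M).
Proof.
move=> phiK psiK; rewrite openE => -[a b] [_ [ma mb] [alpha [beta [ra rb uM]]]].
have KM := uM.1.1.
have /(no_multiple_rootE ra.1) ainj := ma.
have /(no_multiple_rootE rb.1) binj := mb.
have [e [[e0 sa] [sb lt]]] : exists e : R, (0 < e /\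
    (forall i j, i != j -> 2 * e <= Normc.normc (alpha i - alpha j))) /\
    ((forall i j, i != j -> 2 * e <= Normc.normc (beta i - beta j)) /\
    forall P : 'S_d, sym_perm_mx R phi psi P != M ->
      forall alpha' beta' : 'I_d -> R[i],
      (forall i, Normc.normc (alpha' i - alpha i) < e) ->
      (forall j, Normc.normc (beta' j - beta j) < e) ->
      cost alpha' beta' M < cost alpha' beta' (sym_perm_mx R phi psi P)).
  apply: (@filter_ex _ (0 : R)^'+); apply: filterI; apply: filterI.
  - exact: nbhs_right_gt.
  - exact: near0_separated.
  - exact: near0_separated.
  - apply: (filter_forall (at_right_proper_filter (0 : R))) => P.
    have [->|PM] := eqVneq (sym_perm_mx R phi psi P) M; first by apply: nearW.
    have := (unique_minimizer_sym_perm _ _ phiK psiK KM).1 uM P PM.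
    by move=> /near0_cost_lt; apply: filterS => e + _; apply.
have na := near_perturbed_roots e0 sa ra.
have nb := near_perturbed_roots e0 sb rb.
exists ([set a' | exists alpha' : 'I_d -> R[i],
    [/\ ordered_roots phi (monic_poly a') alpha', no_multiple_root (monic_poly a') &
        forall i, Normc.normc (alpha' i - alpha i) < e]],
  [set b' | exists beta' : 'I_d -> R[i],
    [/\ ordered_roots psi (monic_poly b') beta', no_multiple_root (monic_poly b') &
        forall i, Normc.normc (beta' i - beta i) < e]]) => //.
move=> [a' b'] [/= [alpha' [ra' ma' ea]] [beta' [rb' mb' eb]]].
have [homo _ _] := monic_poly_bij R d.
split=> //; first by split; exact: homo.
exists alpha', beta'; split=> //.
apply/(unique_minimizer_sym_perm _ _ phiK psiK KM) => P PM.
exact: lt.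
Qed.

(** * Regular polygons on the unit circle *)

Definition circle_angle (R : realType) (n : nat) (m : int) : R :=
  m%:~R * (pi / n%:R).

(** The point [exp (i * pi * m / n)]; for consecutive [m] these points are the
    vertices of a regular [2n]-gon. *)
Definition circle_point (R : realType) (n : nat) (m : int) : R[i] :=
  (cos (circle_angle R n m) +i* sin (circle_angle R n m))%C.

(** The squared side length of the regular [2n]-gon. *)
Definition sqr_side (R : realType) (n : nat) : R := 2 - 2 * cos (circle_angle R n 1).

Lemma circle_angleD (R : realType) n m m' :
  circle_angle R n (m + m') = circle_angle R n m + circle_angle R n m'.
Proof. by rewrite /circle_angle rmorphD mulrDl. Qed.

Lemma circle_angleN (R : realType) n m : circle_angle R n (- m) = - circle_angle R n m.
Proof. by rewrite /circle_angle rmorphN mulNr. Qed.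

Lemma cos_sin_period (R : realType) (x : R) (q : int) :
  cos (x + q%:~R * (pi *+ 2)) = cos x /\ sin (x + q%:~R * (pi *+ 2)) = sin x.
Proof.
suff nat_period (y : R) k :
    cos (y + k%:R * (pi *+ 2)) = cos y /\ sin (y + k%:R * (pi *+ 2)) = sin y.
  case: q => k; first exact: nat_period.
  have [<- <-] := nat_period (x + (Negz k)%:~R * (pi *+ 2)) k.+1.
  by rewrite NegzE rmorphN mulNr subrK.
rewrite mulr_natl; split; first exact: (periodicn (@cosD2pi R)).
exact: (periodicn (@sinD2pi R)).
Qed.

Lemma circle_angle_eqmod (R : realType) n (m m' : int) : (0 < n)%N ->
  (n%:Z *+ 2 %| m - m')%Z ->
  exists q : int, circle_angle R n m = circle_angle R n m' + q%:~R * (pi *+ 2).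
Proof.
move=> n0 /dvdzP[q mE]; exists q.
rewrite -[m](subrK m') mE addrC circle_angleD; congr (_ + _).
rewrite /circle_angle !mulr2n intrM intrD -[n%:~R]/(n%:R : R).
by field; rewrite pnatr_eq0 -lt0n.
Qed.

Lemma circle_point_eqmod (R : realType) n (m m' : int) : (0 < n)%N ->
  (n%:Z *+ 2 %| m - m')%Z -> circle_point R n m = circle_point R n m'.
Proof.
move=> n0 /(circle_angle_eqmod R n0)[q e]; rewrite /circle_point e.
by have [-> ->] := cos_sin_period (circle_angle R n m') q.
Qed.

Lemma conjc_circle_point (R : realType) n (m : int) :
  conjc (circle_point R n m) = circle_point R n (- m).
Proof. by rewrite /circle_point circle_angleN cosN sinN. Qed.

Lemma normc_circle_point (R : realType) n (m : int) : Normc.normc (circle_point R n m) = 1.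
Proof. by rewrite /= cos2Dsin2 sqrtr1. Qed.

Lemma sqr_normc_circle_pointle_pointB (R : realType) n (m m' : int) :
  Normc.normc (circle_point R n m - circle_point R n m') ^+ 2 =
  2 - 2 * cos (circle_angle R n (m - m')).
Proof.
rewrite /= sqr_sqrtr ?addr_ge0 ?sqr_ge0 // circle_angleD circle_angleN cosB.
have := cos2Dsin2 (circle_angle R n m); have := cos2Dsin2 (circle_angle R n m').
move: (cos _) (sin _) (cos _) (sin _) => c' s' c s e' e.
transitivity ((c ^+ 2 + s ^+ 2) + (c' ^+ 2 + s' ^+ 2) - 2 * (c * c' + s * s')).
  by ring.
by rewrite e e'; ring.
Qed.

(** The value of the cosine depends on [m] only up to sign and modulo [2n], so
    the angle can be brought to the interval from [0] to [pi], where the cosine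
    is decreasing. *)
Lemma circle_angle_fold (R : realType) n (m : int) : (0 < n)%N ->
  exists s : nat, [/\ (s <= n)%N,
    (n%:Z *+ 2 %| m - s%:Z)%Z \/ (n%:Z *+ 2 %| m + s%:Z)%Z &
    cos (circle_angle R n m) = cos (circle_angle R n s)].
Proof.
move=> n0; suff [s [sn ds]] : exists s : nat, (s <= n)%N /\
    ((n%:Z *+ 2 %| m - s%:Z)%Z \/ (n%:Z *+ 2 %| m + s%:Z)%Z).
  exists s; split=> //; case: ds => [/(circle_angle_eqmod R n0)[q ->]|].
    exact: (cos_sin_period _ _).1.
  rewrite -{1}[Posz s]opprK => /(circle_angle_eqmod R n0)[q ->].
  by rewrite (cos_sin_period _ _).1 circle_angleN cosN.
have N0 : n%:Z *+ 2 != 0 by lia.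
have := modz_ge0 m N0; have : (m %% (n%:Z *+ 2))%Z < n%:Z *+ 2.
  by apply: ltz_pmod; lia.
have := divz_eq m (n%:Z *+ 2); set q := (m %/ _)%Z.
case: (m %% _)%Z => // r mE rlt _.
have [rn|nr] := leqP r n.
  exists r; split=> //; left; apply/dvdzP; exists q; lia.
exists (n.*2 - r)%N; split; first lia.
right; apply/dvdzP; exists (q + 1); lia.
Qed.

Lemma circle_angle_in_0pi (R : realType) n (s : nat) : (0 < n)%N -> (s <= n)%N ->
  circle_angle R n s \in `[0, pi]%R.
Proof.
move=> n0 sn; have n0' : (0 : R) < n%:R by rewrite ltr0n.
rewrite in_itv /= /circle_angle mulr_ge0 ?divr_ge0 ?pi_ge0 ?ler0n //=.
rewrite mulrCA ger_pMr ?pi_gt0 // ler_pdivrMr // mul1r.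
by rewrite -[_%:~R]/(s%:R) ler_nat.
Qed.

Lemma sqr_side_gt0 (R : realType) n : (0 < n)%N -> 0 < sqr_side R n.
Proof.
move=> n0; rewrite /sqr_side -[X in X - _]mulr1 -mulrBr mulr_gt0 // subr_gt0.
rewrite -(@cos0 R) ltr_cos ?in_itv /= ?lexx ?pi_ge0 //.
  by rewrite /circle_angle mul1r divr_gt0 ?pi_gt0 ?ltr0n.
exact: circle_angle_in_0pi.
Qed.

Lemma sqr_side_le4 (R : realType) n : sqr_side R n <= 4.
Proof. by rewrite /sqr_side; have := cos_geN1 (circle_angle R n 1); lra. Qed.

Lemma circle_dist_ge_side (R : realType) n (m m' : int) : (0 < n)%N ->
  ~~ (n%:Z *+ 2 %| m - m')%Z ->
  sqr_side R n <= Normc.normc (circle_point R n m - circle_point R n m') ^+ 2.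
Proof.
move=> n0 ndvd; rewrite sqr_normc_circle_pointle_pointB.
have [s [sn ds ->]] := circle_angle_fold R (m - m') n0.
suff : cos (circle_angle R n s) <= cos (circle_angle R n 1) by rewrite /sqr_side; lra.
case: s sn ds => [|s] sn ds; first by case: ds ndvd; rewrite ?subr0 ?addr0 => ->.
have pi0 : 0 < pi / n%:R :> R by rewrite divr_gt0 ?pi_gt0 ?ltr0n.
rewrite leNgt ltr_cos ?circle_angle_in_0pi // -leNgt.
by rewrite /circle_angle ler_pM2r // ler_int.
Qed.

Lemma circle_dist_eq_side (R : realType) n (m m' : int) : (0 < n)%N ->
  Normc.normc (circle_point R n m - circle_point R n m') ^+ 2 = sqr_side R n <->
  (n%:Z *+ 2 %| m - m' - 1)%Z \/ (n%:Z *+ 2 %| m - m' + 1)%Z.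
Proof.
move=> n0; rewrite sqr_normc_circle_pointle_pointB /sqr_side; split=> [e|].
  have [s [sn ds cE]] := circle_angle_fold R (m - m') n0.
  have : circle_angle R n s = circle_angle R n 1.
    apply: cos_inj; rewrite ?circle_angle_in_0pi //.
    by rewrite -cE; move: e; lra.
  have pi0 : pi / n%:R != 0 :> R by rewrite gt_eqF // divr_gt0 ?pi_gt0 ?ltr0n.
  by move=> /(mulIf pi0)/eqP; rewrite eqr_int => /eqP[s1]; move: ds; rewrite s1.
case=> [/(circle_angle_eqmod R n0)[q ->]|].
  by rewrite (cos_sin_period _ _).1.
rewrite -[X in (_ %| _ + X)%Z]opprK => /(circle_angle_eqmod R n0)[q ->].
by rewrite (cos_sin_period _ _).1 circle_angleN cosN.
Qed.

(** * Embedding a dihedral orbit in the plane *)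

(** Lets computations in the cycle of [x] be done on exponents modulo its
    length. *)
Lemma eq_perm_exp (T : finType) (s : {perm T}) (x : T) (k l : nat) :
  ((s ^+ k)%g x == (s ^+ l)%g x) = (k == l %[mod #|porbit s x|]).
Proof.
set n := #|porbit s x|; have n0 : (0 < n)%N by rewrite lt0n card_porbit_neq0.
have modE m : (s ^+ m)%g x = nth x (traject s x n) (m %% n).
  rewrite nth_traject ?ltn_pmod // permX {1}(divn_eq m n) addnC iterD.
  by elim: (m %/ n)%N => // q IHq; rewrite mulSnr iterD iter_porbit.
by rewrite !modE nth_uniq ?size_traject ?ltn_pmod // uniq_traject_porbit.
Qed.

Lemma dvdz_double_nat (n k l : nat) :
  (n%:Z *+ 2 %| (k%:Z - l%:Z) *+ 2)%Z = (k == l %[mod n]).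
Proof.
rewrite -[n%:Z *+ 2]mulr_natr -[(_ - _) *+ 2]mulr_natr dvdz_mul2r //.
by rewrite -eqz_mod_dvd !modz_nat.
Qed.

Section Dihedral.
Variables (d : nat) (phi sigma : 'S_d).
Hypothesis phiK : involutive phi.
Hypothesis sigmaJ : forall i, sigma (phi (sigma i)) = phi i.

(** [phi] reverses the cycles of [sigma]: it conjugates [sigma] to its
    inverse. *)
Lemma sigma_phi_exp k i : (sigma ^+ k)%g (phi ((sigma ^+ k)%g i)) = phi i.
Proof.
by elim: k i => [|k IHk] i; rewrite ?expg0 ?perm1 // {1}expgSr permM expgS permM IHk.
Qed.

Lemma phi_porbit i k : i \in porbit sigma k -> phi i \in porbit sigma (phi k).
Proof.
by move=> /porbitP[n ->]; rewrite porbit_sym -{1}(sigma_phi_exp n k) mem_porbit.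
Qed.

(** The orbit of [i] under the group generated by [phi] and [sigma]: as [phi]
    maps cycles of [sigma] to cycles, two of them suffice. *)
Definition dihedral_orbit i : {set 'I_d} :=
  (porbit sigma i :|: porbit sigma (phi i))%SET.

Lemma dihedral_orbit_phi i : dihedral_orbit (phi i) = dihedral_orbit i.
Proof. by rewrite /dihedral_orbit phiK finset.setUC. Qed.

Lemma dihedral_orbit_sigma i : dihedral_orbit (sigma i) = dihedral_orbit i.
Proof.
rewrite /dihedral_orbit; congr (_ :|: _)%SET.
  by have := porbit_perm sigma 1 i; rewrite expg1.
by have := porbit_perm sigma 1 (phi (sigma i)); rewrite expg1 sigmaJ.
Qed.

Lemma dihedral_orbit_refl i : i \in dihedral_orbit i.
Proof. by rewrite inE porbit_id. Qed.

Lemma dihedral_orbit_eq i k :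
  k \in dihedral_orbit i -> dihedral_orbit k = dihedral_orbit i.
Proof.
have orb x y : x \in porbit sigma y -> dihedral_orbit x = dihedral_orbit y.
  move=> xy; rewrite /dihedral_orbit; congr (_ :|: _)%SET.
    by apply/eqP; rewrite eq_porbit_mem.
  by apply/eqP; rewrite eq_porbit_mem phi_porbit.
by rewrite inE => /orP[/orb // | /orb ->]; rewrite dihedral_orbit_phi.
Qed.

(** Positions [u] of the rows and [v] of the columns of one orbit, equivariant
    for conjugation, such that the squared distance from a row to a column is
    minimal, equal to [f], exactly when the column is in the support of the row.
    The bounds on [u], [v] and [f] serve to keep different orbits apart. *)
Record component_embedding (R : realType) (C : {set 'I_d})
    (u v : 'I_d -> R[i]) (f : R) : Prop := ComponentEmbedding {
  embed_f : 0 <= f <= 4;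
  embed_u1 : forall i, i \in C -> Normc.normc (u i) <= 1;
  embed_v1 : forall i, i \in C -> Normc.normc (v i) <= 1;
  embed_uJ : forall i, i \in C -> conjc (u i) = u (phi i);
  embed_vJ : forall i, i \in C -> conjc (v i) = v (sigma (phi i));
  embed_u_inj : {in C &, injective u};
  embed_v_inj : {in C &, injective v};
  embed_ge : forall i k, i \in C -> k \in C ->
    f <= Normc.normc (u i - v k) ^+ 2;
  embed_eq : forall i k, i \in C -> k \in C ->
    Normc.normc (u i - v k) ^+ 2 = f <-> k = i \/ k = sigma i
}.

(** Number the cycle by [i = sigma ^+ k r], so that [phi] acts on numbers as the
    reflection [k |-> c - k] modulo [n] and [sigma \o phi] as
    [k |-> c + 1 - k].  Placing row [k] at the vertex [2 * k - c] of a regular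
    [2n]-gon and column [k] at the vertex [2 * k - 1 - c] turns both reflections
    into [m |-> - m], which is complex conjugation.  The neighbours of the
    vertex of row [k] are the columns [k] and [k + 1]. *)
Lemma polygon_embedding (R : realType) (r : 'I_d) : phi r \in porbit sigma r ->
  exists (u v : 'I_d -> R[i]) (f : R),
    component_embedding (dihedral_orbit r) u v f.
Proof.
move=> phir.
have -> : dihedral_orbit r = porbit sigma r.
  move: (phir); rewrite -eq_porbit_mem => /eqP e.
  by rewrite /dihedral_orbit e finset.setUid.
have /porbitP[c phirE] := phir.
have /choice[k kP] i : exists k : nat, i \in porbit sigma r -> i = (sigma ^+ k)%g r.
  have [/porbitP[k ->]|//] := boolP (i \in porbit sigma r); first by exists k.
  by exists 0%N.
set n := #|porbit sigma r|.
have n0 : (0 < n)%N by rewrite lt0n card_porbit_neq0.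
have phiC i : i \in porbit sigma r -> phi i \in porbit sigma r.
  by move=> /phi_porbit; move: phir; rewrite -eq_porbit_mem => /eqP ->.
have sigmaC i : i \in porbit sigma r -> sigma i \in porbit sigma r.
  have := porbit_perm sigma 1 i; rewrite expg1 => e ir.
  by rewrite -eq_porbit_mem e eq_porbit_mem.
have k_inj i j : i \in porbit sigma r -> j \in porbit sigma r ->
    k i == k j %[mod n] -> i = j.
  by move=> ir jr; rewrite -eq_perm_exp => /eqP; rewrite -!kP.
have k_phi i : i \in porbit sigma r -> (k i + k (phi i))%N == c %[mod n].
  move=> ir; rewrite -eq_perm_exp -phirE addnC expgD permM -(kP (phi i)) ?phiC //.
  by rewrite {2}(kP i) // sigma_phi_exp.
have k_sigma i : i \in porbit sigma r -> k (sigma i) == (k i).+1 %[mod n].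
  by move=> ir; rewrite -eq_perm_exp expgSr permM -!kP ?sigmaC.
exists (fun i => circle_point R n ((k i)%:Z *+ 2 - c%:Z)),
  (fun i => circle_point R n ((k i)%:Z *+ 2 - 1 - c%:Z)), (sqr_side R n).
split.
- by rewrite ltW ?sqr_side_gt0 // sqr_side_le4.
- by move=> i _; rewrite normc_circle_point.
- by move=> i _; rewrite normc_circle_point.
- move=> i ir; rewrite conjc_circle_point; apply/esym/circle_point_eqmod => //.
  have := k_phi i ir; rewrite -dvdz_double_nat; congr (_ %| _)%Z; lia.
- move=> i ir; rewrite conjc_circle_point; apply/esym/circle_point_eqmod => //.
  have : (k i + k (sigma (phi i)))%N == c.+1 %[mod n].
    have /eqP e1 := k_phi i ir; have /eqP e2 := k_sigma _ (phiC i ir).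
    by rewrite -modnDmr e2 modnDmr addnS -addn1 -modnDml e1 modnDml addn1.
  rewrite -dvdz_double_nat; congr (_ %| _)%Z; lia.
- move=> i j ir jr e; apply: k_inj => //; rewrite -dvdz_double_nat.
  apply: contraT => /negP ndvd.
  have := @circle_dist_ge_side R n ((k i)%:Z *+ 2 - c%:Z) ((k j)%:Z *+ 2 - c%:Z) n0.
  rewrite e subrr Normc.normc0 expr0n /= leNgt sqr_side_gt0 //; apply.
  by apply/negP => h; apply: ndvd; move: h; congr (_ %| _)%Z; lia.
- move=> i j ir jr e; apply: k_inj => //; rewrite -dvdz_double_nat.
  apply: contraT => /negP ndvd.
  have := @circle_dist_ge_side R n ((k i)%:Z *+ 2 - 1 - c%:Z)
    ((k j)%:Z *+ 2 - 1 - c%:Z) n0.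
  rewrite e subrr Normc.normc0 expr0n /= leNgt sqr_side_gt0 //; apply.
  by apply/negP => h; apply: ndvd; move: h; congr (_ %| _)%Z; lia.
- move=> i j ir jr; apply: circle_dist_ge_side => //.
  by apply/negP => /dvdzP[q]; lia.
- move=> i j ir jr; rewrite circle_dist_eq_side //.
  have -> : (n%:Z *+ 2 %| (k i)%:Z *+ 2 - c%:Z - ((k j)%:Z *+ 2 - 1 - c%:Z) - 1)%Z =
      (k i == k j %[mod n]).
    rewrite -dvdz_double_nat; congr (_ %| _)%Z; lia.
  have -> : (n%:Z *+ 2 %| (k i)%:Z *+ 2 - c%:Z - ((k j)%:Z *+ 2 - 1 - c%:Z) + 1)%Z =
      ((k i).+1 == k j %[mod n]).
    rewrite -dvdz_double_nat; congr (_ %| _)%Z; lia.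
  split=> [[e|/eqP e]|[->|->]].
  + by left; apply/esym/k_inj.
  + by right; apply: k_inj; rewrite ?sigmaC // -e eq_sym k_sigma.
  + by left.
  + by right; rewrite eq_sym k_sigma.
Qed.

(** Both cycles of the orbit are trivial, so each row is supported on one
    column, which may be put at the same point. *)
Lemma conjugate_pair_embedding (R : realType) (r : 'I_d) :
  sigma r = r -> phi r != r ->
  exists (u v : 'I_d -> R[i]) (f : R),
    component_embedding (dihedral_orbit r) u v f.
Proof.
move=> sr pr.
have spr : sigma (phi r) = phi r by rewrite -{1}sr sigmaJ.
have porbit_fix x : sigma x = x -> porbit sigma x = [set x]%SET.
  move=> sx; apply/setP => y; rewrite inE; apply/porbitP/eqP => [[k ->]|->].
    by elim: k => [|k IHk]; rewrite ?expg0 ?perm1 // expgSr permM IHk.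
  by exists 0%N; rewrite expg0 perm1.
have inC i : i \in dihedral_orbit r -> i = r \/ i = phi r.
  by rewrite !inE !porbit_fix // !inE => /orP[] /eqP ->; [left|right].
pose u i : R[i] := if i == r then 'i%C else (- 'i)%C.
have ur : u r = 'i%C by rewrite /u eqxx.
have upr : u (phi r) = (- 'i)%C by rewrite /u (negbTE pr).
have neq : 'i%C != (- 'i)%C :> R[i].
  by rewrite eq_complex /= oppr0 eqxx /= -subr_eq0 opprK paddr_eq0 // oner_eq0.
have dist : Normc.normc ('i%C - (- 'i)%C : R[i]) ^+ 2 != 0.
  rewrite sqrf_eq0; apply: contra neq => /eqP/Normc.eq0_normc/eqP.
  by rewrite subr_eq0.
have u1 i : Normc.normc (u i) <= 1.
  by rewrite /u; case: ifP; rewrite /= ?oppr0 ?sqrrN expr0n expr1n add0r sqrtr1.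
have uJ i : i \in dihedral_orbit r -> conjc (u i) = u (phi i).
  by move=> /inC[] ->; rewrite ?phiK ?ur ?upr //= ?opprK ?oppr0; apply/eqP;
    rewrite eq_complex /= ?oppr0 ?opprK !eqxx.
have u_inj : {in dihedral_orbit r &, injective u}.
  move=> i j /inC[] -> /inC[] ->; rewrite ?ur ?upr // => /eqP.
    by rewrite (negbTE neq).
  by rewrite eq_sym (negbTE neq).
have sC i : i \in dihedral_orbit r -> sigma i = i by move=> /inC[] ->.
exists u, u, 0; split=> //.
- by rewrite lexx /=.
- move=> i iC; rewrite uJ // sC //.
  by rewrite -(dihedral_orbit_eq iC) -dihedral_orbit_phi dihedral_orbit_refl.
- by move=> i j _ _; apply: sqr_ge0.
- move=> i j iC jC; rewrite sC //; split=> [/eqP|ji].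
    rewrite sqrf_eq0 => /eqP/Normc.eq0_normc/eqP; rewrite subr_eq0 => /eqP e.
    by left; apply: u_inj.
  have -> : j = i by case: ji.
  by rewrite subrr Normc.normc0 expr0n.
Qed.

End Dihedral.

(** * Non-emptiness *)

(** Otherwise [phi] sends the cycle of [i] to a disjoint cycle [A].  Choosing
    the first of the two supporting columns on the cycle of [i] and the second
    one on [A] is a choice invariant under the symmetry, hence gives a matrix of
    the polytope whose support is in that of the vertex.  It is then the vertex
    itself.  But it has entry [1] at row [i] and column [P i], whereas the entry
    of the vertex there is [1 / 2] unless [sigma i = i]. *)
Lemma vertex_orbit_symmetric (R : realType) (d : nat) (phi psi P : 'S_d) :
  involutive phi -> involutive psi ->
  vertex (birkhoff_inv phi psi) (sym_perm_mx R phi psi P) ->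
  let sigma := (phi * P * psi * P^-1)%g in
  forall i, sigma i = i \/ phi i \in porbit sigma i.
Proof.
move=> phiK psiK vM sigma i0.
have sigmaE i : sigma i = (P^-1)%g (psi (P (phi i))) by rewrite !permM.
have Psigma i : P (sigma i) = psi (P (phi i)) by rewrite sigmaE permKV.
pose A := porbit sigma (phi i0).
have sA i : (sigma i \in A) = (i \in A).
  have := porbit_perm sigma 1 i; rewrite expg1 => e.
  by rewrite /A -!eq_porbit_mem e.
have [|nporb] := boolP (phi i0 \in porbit sigma i0); first by right.
left; have i0A : i0 \notin A by rewrite porbit_sym.
have phii0A : phi i0 \in A by apply: porbit_id.
pose s i := if i \in A then sigma i else i.
have s_inj : injective s.
  move=> i j; rewrite /s; case: ifPn => iA; case: ifPn => jA //.
  - exact: perm_inj.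
  - by move=> e; move: jA; rewrite -e sA iA.
  - by move=> e; move: iA; rewrite e sA jA.
(* [Q] takes the column of [sigma i] on [A] and that of [i] elsewhere. *)
pose Q := (perm s_inj * P)%g.
have QE i : Q i = P (s i) by rewrite permM permE.
have : sym_perm_mx R phi psi Q = sym_perm_mx R phi psi P.
  apply: (vertex_support vM); first exact: sym_perm_mx_birkhoff_inv.
  move=> i j; rewrite !sym_perm_mx_neq0 -Psigma.
  move=> /orP[] /eqP <-; rewrite QE /s.
    by case: ifPn => _; rewrite eqxx ?orbT.
  case: ifPn => _; first by rewrite (sigmaE (phi i)) permKV psiK phiK eqxx.
  by rewrite -Psigma eqxx orbT.
move=> /matrixP/(_ i0 (P i0)); rewrite !sym_perm_mxE !QE /s (negbTE i0A) phii0A.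
rewrite eqxx Psigma phiK psiK eqxx -Psigma (inj_eq perm_inj).
by case: eqVneq => //= _ h; exfalso; move: h; lra.
Qed.

Lemma real_poly_of_roots (R : realType) (d : nat) (phi : 'S_d)
    (alpha : 'I_d -> R[i]) :
  (forall i, conjc (alpha i) = alpha (phi i)) ->
  exists p : {poly R}, monic_of_degree d p /\ ordered_roots phi p alpha.
Proof.
move=> alphaJ; pose q := \prod_(i < d) ('X - (alpha i)%:P).
have qJ : map_poly conjc q = q.
  rewrite /q rmorph_prod /= [RHS](reindex_inj (@perm_inj _ phi)) /=.
  by apply: eq_bigr => i _; rewrite rmorphB /= map_polyX map_polyC /= alphaJ.
pose p := map_poly (@complex.Re R) q.
(* The coefficients of [q] are fixed by conjugation, hence real. *)
have pE : map_poly (real_complex R) p = q.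
  apply/polyP => k; rewrite coef_map /= coef_map_id0 //.
  have : conjc q`_k = q`_k by rewrite -[in RHS]qJ coef_map.
  case: (q`_k) => a b /= [] /eqP; rewrite eq_sym -subr_eq0 opprK -mulr2n.
  by rewrite mulrn_eq0 /= => /eqP ->.
exists p; split=> //; split.
  by rewrite -(map_monic (real_complex R)) pE monic_prod_XsubC.
rewrite -(size_map_poly (real_complex R)) pE size_prod_XsubC.
by rewrite /index_enum -enumT -cardE card_ord.
Qed.

(** Linear programming duality: as all the row sums are one, replacing the
    squared distance by its excess over [f i] shifts the cost by a constant.
    The excess is non-negative and vanishes exactly on the support of [M]. *)
Lemma potential_unique_minimizer (R : realType) (d : nat) (phi psi : 'S_d)
    (M : 'M[R]_d) (alpha beta : 'I_d -> R[i]) (f : 'I_d -> R) :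
  vertex (birkhoff_inv phi psi) M ->
  (forall i j, f i <= Normc.normc (alpha i - beta j) ^+ 2) ->
  (forall i j, M i j != 0 <-> Normc.normc (alpha i - beta j) ^+ 2 = f i) ->
  unique_minimizer (birkhoff_inv phi psi) (cost alpha beta) M.
Proof.
move=> vM fle feq; pose c i j := Normc.normc (alpha i - beta j) ^+ 2.
have cf i j : 0 <= c i j - f i by rewrite subr_ge0; apply: fle.
pose slack (N : 'M[R]_d) := \sum_i \sum_j N i j * (c i j - f i).
have slack_ge0 N : birkhoff_inv phi psi N -> 0 <= slack N.
  move=> [[N0 _ _] _]; apply: sumr_ge0 => i _; apply: sumr_ge0 => j _.
  by rewrite mulr_ge0.
have costE N : birkhoff_inv phi psi N ->
    cost alpha beta N = d%:R^-1 * (slack N + \sum_i f i).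
  move=> [[_ Nr _] _]; rewrite /cost -big_split /=; congr (_ * _).
  apply: eq_bigr => i _.
  transitivity (\sum_j (N i j * (c i j - f i) + N i j * f i)).
    by apply: eq_bigr => j _; rewrite -mulrDr subrK.
  by rewrite big_split /= -mulr_suml Nr mul1r.
have slackM : slack M = 0.
  rewrite /slack big1 // => i _; rewrite big1 // => j _.
  have [->|/feq e] := eqVneq (M i j) 0; first by rewrite mul0r.
  by rewrite /c e subrr mulr0.
have minM N : birkhoff_inv phi psi N -> cost alpha beta M <= cost alpha beta N.
  move=> KN; rewrite (costE _ KN) (costE _ vM.1) slackM ler_wpM2l ?invr_ge0 //.
  by rewrite lerD2r slack_ge0.
split; first by split=> //; exact: vM.1.
move=> N [KN /(_ _ vM.1)]; rewrite (costE _ KN) (costE _ vM.1) slackM => le.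
apply: (vertex_support vM) => // i j; apply: contraNneq => Mij.
have d0 : 0 < (d%:R^-1 : R).
  by rewrite invr_gt0 ltr0n (leq_ltn_trans (leq0n i)).
move: le; rewrite ler_pM2l // lerD2r => le0.
have /eqP : slack N = 0 by apply/le_anti; rewrite le0 slack_ge0.
have [[N0 _ _] _] := KN.
have ge0 k l : 0 <= N k l * (c k l - f k) by rewrite mulr_ge0.
rewrite psumr_eq0 => [/allP/(_ i (mem_index_enum _))/=|k _]; last exact: sumr_ge0.
rewrite psumr_eq0 // => /allP/(_ j (mem_index_enum _))/=.
rewrite mulf_eq0 => /orP[//|]; rewrite subr_eq0 => /eqP /feq.
by rewrite Mij eqxx.
Qed.

(** Each orbit is embedded around [10 * r], where [r] is a representative.
    Points of different orbits are then at distance at least [8], whereas no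
    constant [f i] exceeds [4]. *)
Lemma dihedral_embedding (R : realType) (d : nat) (phi sigma : 'S_d) :
  involutive phi -> (forall i, sigma (phi (sigma i)) = phi i) ->
  (forall i, sigma i = i \/ phi i \in porbit sigma i) ->
  exists (a b : 'I_d -> R[i]) (f : 'I_d -> R),
    [/\ injective a /\ injective b,
        forall i, conjc (a i) = a (phi i),
        forall i, conjc (b i) = b (sigma (phi i)),
        forall i k, f i <= Normc.normc (a i - b k) ^+ 2 &
        forall i k, Normc.normc (a i - b k) ^+ 2 = f i <-> k = i \/ k = sigma i].
Proof.
move=> phiK sigmaJ sym.
have embed r : exists E : ('I_d -> R[i]) * ('I_d -> R[i]) * R,
    component_embedding phi sigma (dihedral_orbit phi sigma r) E.1.1 E.1.2 E.2.
  have [pr|npr] := boolP (phi r \in porbit sigma r).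
    by have [u [v [f E]]] := polygon_embedding sigmaJ R pr; exists (u, v, f).
  have sr : sigma r = r by case: (sym r) => // h; rewrite h in npr.
  have pr : phi r != r by apply: contraNneq npr => ->; apply: porbit_id.
  have [u [v [f E]]] := conjugate_pair_embedding phiK sigmaJ R sr pr.
  by exists (u, v, f).
have /choice[E EP] := embed.
pose C := dihedral_orbit phi sigma.
pose r i := odflt i [pick x in C i].
have rC i : r i \in C i.
  rewrite /r; case: pickP => [x //|] /(_ i).
  by rewrite dihedral_orbit_refl.
have r_eq i k : C i = C k -> r i = r k.
  move=> e; rewrite /r e; case: pickP => // /(_ k).
  by rewrite dihedral_orbit_refl.
have Cr i : C (r i) = C i by apply: (dihedral_orbit_eq phiK sigmaJ).
have iCr i : i \in C (r i) by rewrite Cr dihedral_orbit_refl.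
have rphi i : r (phi i) = r i by apply/r_eq/(dihedral_orbit_phi _ phiK).
have rsigma i : r (sigma i) = r i by apply/r_eq/(dihedral_orbit_sigma sigmaJ).
pose u i := (E (r i)).1.1 i; pose v i := (E (r i)).1.2 i.
pose shift i : R[i] := real_complex R (10 * (r i)%:R).
have u1 i : Normc.normc (u i) <= 1 by apply: (embed_u1 (EP (r i))).
have v1 i : Normc.normc (v i) <= 1 by apply: (embed_v1 (EP (r i))).
have far (x y : 'I_d -> R[i]) i k :
    Normc.normc (x i) <= 1 -> Normc.normc (y k) <= 1 -> r i != r k ->
    8 <= Normc.normc (shift i + x i - (shift k + y k)).
  move=> x1 y1 rik.
  have : 10 <= Normc.normc (shift i - shift k).
    rewrite -rmorphB normc_real -mulrBr normrM normr_nat ler_peMr //.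
    have -> : (r i)%:R - (r k)%:R = ((r i)%:Z - (r k)%:Z)%:~R :> R.
      by rewrite rmorphB.
    rewrite -intr_norm -[1]/(1%:~R) ler_int.
    by move: rik; rewrite -val_eqE /=; lia.
  have -> : shift i - shift k =
      (shift i + x i - (shift k + y k)) - (x i - y k) by ring.
  have := normc_triangle (shift i + x i - (shift k + y k)) 0 (x i - y k).
  rewrite subr0 sub0r normcN.
  have := normc_triangle (x i) 0 (y k); rewrite subr0 sub0r normcN; lra.
have near (x y : 'I_d -> R[i]) i k : r i = r k ->
    shift i + x i - (shift k + y k) = x i - y k.
  by move=> e; rewrite /shift e opprD addrACA subrr add0r.
have glue_inj (x : 'I_d -> R[i]) : (forall i, Normc.normc (x i) <= 1) ->
    (forall i k, r i = r k -> x i = x k -> i = k) ->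
    injective (fun i => shift i + x i).
  move=> x1 xinj i k /= e; have [rik|rik] := eqVneq (r i) (r k).
    by apply: xinj => //; move: e; rewrite /shift rik => /addrI.
  have := far x x i k (x1 i) (x1 k) rik; rewrite e subrr Normc.normc0.
  by rewrite lern0.
have conjD (x y : R[i]) : conjc (x + y) = conjc x + conjc y by rewrite rmorphD.
have shiftJ i : conjc (shift i) = shift i by rewrite /shift /= oppr0.
exists (fun i => shift i + u i), (fun i => shift i + v i), (fun i => (E (r i)).2).
split.
- split; apply: glue_inj => // i k rik e.
    apply: (embed_u_inj (EP (r i))) => //; first by rewrite rik.
    by move: e; rewrite /u rik.
  apply: (embed_v_inj (EP (r i))) => //; first by rewrite rik.
  by move: e; rewrite /v rik.
- move=> i; rewrite conjD shiftJ /shift /u rphi; congr (_ + _).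
  exact: (embed_uJ (EP (r i))).
- move=> i; rewrite conjD shiftJ /shift /v rsigma rphi; congr (_ + _).
  exact: (embed_vJ (EP (r i))).
- move=> i k; have [rik|rik] := eqVneq (r i) (r k).
    rewrite near // /v -rik; apply: (embed_ge (EP (r i))) => //.
    by rewrite rik.
  have := far u v i k (u1 i) (v1 k) rik.
  have /andP[_ f4] := embed_f (EP (r i)).
  move: (Normc.normc _) => x x8; apply: le_trans f4 _.
  by apply: (@le_trans _ _ (8 ^+ 2)); [rewrite -natrX ler_nat|rewrite ler_sqr ?nnegrE; lra].
- move=> i k; have [rik|rik] := eqVneq (r i) (r k).
    rewrite near // /v -rik; apply: (embed_eq (EP (r i))) => //.
    by rewrite rik.
  have := far u v i k (u1 i) (v1 k) rik.
  have /andP[_ f4] := embed_f (EP (r i)).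
  move: (Normc.normc _) => x x8; split=> [xf|[ki|ki]].
  + have : 8 ^+ 2 <= x ^+ 2 by rewrite ler_sqr ?nnegrE; lra.
    by rewrite xf => /le_trans/(_ f4); rewrite -natrX ler_nat.
  + by rewrite ki eqxx in rik.
  + by rewrite ki rsigma eqxx in rik.
Qed.

Lemma U_set_nonempty (R : realType) (d : nat) (phi psi : 'S_d) (M : 'M[R]_d) :
  involutive phi -> involutive psi -> vertex (birkhoff_inv phi psi) M ->
  U_set phi psi M !=set0.
Proof.
move=> phiK psiK vM; have [P ME] := vertex_sym_perm phiK psiK vM.
move: vM; rewrite {}ME => vM.
have := vertex_orbit_symmetric phiK psiK vM; rewrite /=.
set sigma := (phi * P * psi * P^-1)%g => sym.
have sigmaE i : sigma i = (P^-1)%g (psi (P (phi i))) by rewrite !permM.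
have sigmaJ i : sigma (phi (sigma i)) = phi i.
  by rewrite !sigmaE phiK permKV psiK permK.
have [a [b [f [[ainj binj] aJ bJ fle feq]]]] := dihedral_embedding R phiK sigmaJ sym.
pose beta j := b ((P^-1)%g j).
have betaJ j : conjc (beta j) = beta (psi j).
  by rewrite /beta bJ sigmaE phiK permKV.
have [p [pm pr]] := real_poly_of_roots aJ.
have [q [qm qr]] := real_poly_of_roots betaJ.
exists (p, q); split=> //=.
- split; first exact/(no_multiple_rootE pr.1).
  by apply/(no_multiple_rootE qr.1) => i j /binj /perm_inj.
- exists a, beta; split=> //.
  apply: (potential_unique_minimizer (f := f)) => //.
    by move=> i j; apply: fle.
  move=> i j; rewrite sym_perm_mx_neq0 feq.
  have inv x : ((P^-1)%g j = x) <-> P x = j.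
    by split=> [<-|<-]; rewrite ?permK ?permKV.
  split=> [/orP[]/eqP h|[/inv <-|/inv <-]].
  + by left; apply/inv.
  + by right; apply/inv; rewrite sigmaE permKV.
  + by rewrite eqxx.
  + by rewrite sigmaE permKV eqxx orbT.
Qed.

Theorem proposition3p9 (R : realType) (d : nat) (phi psi : 'S_d)
    (M : 'M[R]_d) :
  involutive phi -> involutive psi ->
  vertex (birkhoff_inv phi psi) M ->
  open (@monic_pair R d @^-1` U_set phi psi M) /\ U_set phi psi M !=set0.
Proof.
move=> phiK psiK vM; split; first exact: open_U_set.
exact: U_set_nonempty.
Qed.
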